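(* Let $n \geq 2$ and $X=\{X_1,\dots,X_n\}$ (a set with $n$ distinct elements). There exists a Hall set $\mathcal{B} \subset \mathrm{Br}(X)$ such that $$\| [\cdots[[X_n,X_{n-1}],X_{n-2}],\dots,X_1] \|_{\mathcal{B}} = (n-1)!.$$
   Context: The base field is $\mathbb{K}=\mathbb{R}$ or $\mathbb{C}$. $\mathrm{Br}(X)$ is the free magma over $X$: the set of formal binary brackets (rooted planar binary trees with leaves labelled by elements of $X$), with product $(t_1,t_2)$. For $t\in \mathrm{Br}(X)$, $|t|$ is its number of leaves; if $t\notin X$, $t$ is written uniquely as $t=(\lambda(t),\mu(t))$. $\mathcal{L}(X)$ is the free Lie algebra over $X$ and $\mathrm{ev}:\mathrm{Br}(X)\to\mathcal{L}(X)$ is the canonical evaluation ($\mathrm{ev}(x)=x$ for $x\in X$, $\mathrm{ev}((t_1,t_2))=[\mathrm{ev}(t_1),\mathrm{ev}(t_2)]$). A Hall set is a subset $\mathcal{B}\subset\mathrm{Br}(X)$ endowed with a total order $<$ such that: (i) $X\subset\mathcal{B}$; (ii) for all $b_1,b_2\in\mathrm{Br}(X)$, $(b_1,b_2)\in\mathcal{B}$ iff $b_1,b_2\in\mathcal{B}$, $b_1<b_2$ and either $b_2\in X$ or $\lambda(b_2)\leq b_1$; (iii) for all $b_1,b_2\in\mathcal{B}$ with $(b_1,b_2)\in\mathcal{B}$, $b_1<(b_1,b_2)$. By a theorem of Viennot, $\mathrm{ev}$ is injective on $\mathcal{B}$ and $\mathrm{ev}(\mathcal{B})$ is a basis of $\mathcal{L}(X)$.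 For $u=\sum_{c\in\mathcal{B}}\alpha_c\,\mathrm{ev}(c)\in\mathcal{L}(X)$ (finite sum), $\|u\|_{\mathcal{B}}:=\sum_{c}|\alpha_c|$. *)

(* Defs.v *)
From HB Require Import structures.
From mathcomp Require Import all_boot all_order all_algebra.
From mathcomp Require Import complex.
From mathcomp Require Import boolp classical_sets cardinality fsbigop reals.

Set Implicit Arguments.
Unset Strict Implicit.
Unset Printing Implicit Defensive.

Import Order.TTheory GRing.Theory Num.Theory.
Local Open Scope ring_scope.
Local Open Scope quotient_scope.

Variant scalars := RealScalars | ComplexScalars.

Definition base_field (R : realType) (k : scalars) : numFieldType :=
  match k with
  | RealScalars => R
  | ComplexScalars => R[i]
  end.

HB.mixin Record Lmodule_isLieAlgebra (K : pzRingType) L of GRing.Lmodule K L := {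
  lie : L -> L -> L;
  lieDl : forall x y z, lie (x + y) z = lie x z + lie y z;
  lieDr : forall x y z, lie x (y + z) = lie x y + lie x z;
  lieZl : forall a x y, lie (a *: x) y = a *: lie x y;
  lieZr : forall a x y, lie x (a *: y) = a *: lie x y;
  liexx : forall x, lie x x = 0;
  lie_jacobi : forall x y z,
    lie x (lie y z) + lie y (lie z x) + lie z (lie x y) = 0
}.

#[short(type="lieAlgType")]
HB.structure Definition LieAlgebra (K : pzRingType) :=
  {L of GRing.Lmodule K L & Lmodule_isLieAlgebra K L}.

(* The free Lie algebra is the algebra of formal Lie expressions in the
   generators, modulo the congruence generated by the Lie algebra axioms; its
   universal property is [free_lie_universal] below. *)
Inductive lie_term (K X : Type) :=
| LGen of X
| LZero
| LOpp of lie_term K X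
| LAdd of lie_term K X & lie_term K X
| LScale of K & lie_term K X
| LBracket of lie_term K X & lie_term K X.

Arguments LGen {K X}.
Arguments LZero {K X}.

HB.instance Definition _ K X := gen_eqMixin (lie_term K X).
HB.instance Definition _ K X := gen_choiceMixin (lie_term K X).

Inductive lie_eqv (K : fieldType) (X : Type) :
  lie_term K X -> lie_term K X -> Prop :=
| eqv_refl t : lie_eqv t t
| eqv_sym t u : lie_eqv t u -> lie_eqv u t
| eqv_trans u t v : lie_eqv t u -> lie_eqv u v -> lie_eqv t v
| eqv_opp t t' : lie_eqv t t' -> lie_eqv (LOpp t) (LOpp t')
| eqv_add t t' u u' :
    lie_eqv t t' -> lie_eqv u u' -> lie_eqv (LAdd t u) (LAdd t' u')
| eqv_scale a t t' : lie_eqv t t' -> lie_eqv (LScale a t) (LScale a t')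
| eqv_bracket t t' u u' :
    lie_eqv t t' -> lie_eqv u u' -> lie_eqv (LBracket t u) (LBracket t' u')
| eqv_addA t u v : lie_eqv (LAdd t (LAdd u v)) (LAdd (LAdd t u) v)
| eqv_addC t u : lie_eqv (LAdd t u) (LAdd u t)
| eqv_add0 t : lie_eqv (LAdd LZero t) t
| eqv_addN t : lie_eqv (LAdd (LOpp t) t) LZero
| eqv_scaleA a b t : lie_eqv (LScale a (LScale b t)) (LScale (a * b) t)
| eqv_scale1 t : lie_eqv (LScale 1 t) t
| eqv_scaleDr a t u :
    lie_eqv (LScale a (LAdd t u)) (LAdd (LScale a t) (LScale a u))
| eqv_scaleDl a b t :
    lie_eqv (LScale (a + b) t) (LAdd (LScale a t) (LScale b t))
| eqv_bracketDl t u v :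
    lie_eqv (LBracket (LAdd t u) v) (LAdd (LBracket t v) (LBracket u v))
| eqv_bracketDr t u v :
    lie_eqv (LBracket t (LAdd u v)) (LAdd (LBracket t u) (LBracket t v))
| eqv_bracketZl a t u : lie_eqv (LBracket (LScale a t) u) (LScale a (LBracket t u))
| eqv_bracketZr a t u : lie_eqv (LBracket t (LScale a u)) (LScale a (LBracket t u))
| eqv_bracketxx t : lie_eqv (LBracket t t) LZero
| eqv_jacobi t u v :
    lie_eqv (LAdd (LAdd (LBracket t (LBracket u v)) (LBracket u (LBracket v t)))
                  (LBracket v (LBracket t u))) LZero.

Section FreeLie.
Variables (K : fieldType) (X : Type).

Definition lie_eqvb (t u : lie_term K X) : bool := `[< lie_eqv t u >].

Lemma lie_eqvb_refl : reflexive lie_eqvb.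
Proof. by move=> t; apply/asboolP; exact: eqv_refl. Qed.

Lemma lie_eqvb_sym : symmetric lie_eqvb.
Proof. by move=> t u; apply/asboolP/asboolP; exact: eqv_sym. Qed.

Lemma lie_eqvb_trans : transitive lie_eqvb.
Proof.
by move=> u t v /asboolP tu /asboolP uv; apply/asboolP; exact: eqv_trans tu uv.
Qed.

Canonical lie_eqv_equiv :=
  EquivRel lie_eqvb lie_eqvb_refl lie_eqvb_sym lie_eqvb_trans.

Definition free_lie := {eq_quot lie_eqv_equiv}.
HB.instance Definition _ := Choice.on free_lie.
HB.instance Definition _ := EqQuotient.on free_lie.

Lemma free_lieP (t u : lie_term K X) :
  lie_eqv t u <-> \pi_free_lie t = \pi_free_lie u.
Proof.
split=> [tu|/eqmodP/asboolP//].
by apply/eqmodP/asboolP.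
Qed.

Lemma free_lie_repr (t : lie_term K X) : lie_eqv (repr (\pi_free_lie t)) t.
Proof. by apply/free_lieP; rewrite reprK. Qed.

Definition fl_zero : free_lie := \pi_free_lie LZero.
Definition fl_opp (x : free_lie) : free_lie := \pi_free_lie (LOpp (repr x)).
Definition fl_add (x y : free_lie) : free_lie :=
  \pi_free_lie (LAdd (repr x) (repr y)).
Definition fl_scale (a : K) (x : free_lie) : free_lie :=
  \pi_free_lie (LScale a (repr x)).
Definition fl_lie (x y : free_lie) : free_lie :=
  \pi_free_lie (LBracket (repr x) (repr y)).
Definition lie_gen (x : X) : free_lie := \pi_free_lie (LGen x).

Lemma fl_oppE t : fl_opp (\pi_free_lie t) = \pi_free_lie (LOpp t).
Proof. by apply/free_lieP/eqv_opp/free_lie_repr. Qed.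

Lemma fl_addE t u :
  fl_add (\pi_free_lie t) (\pi_free_lie u) = \pi_free_lie (LAdd t u).
Proof. by apply/free_lieP/eqv_add; exact: free_lie_repr. Qed.

Lemma fl_scaleE a t : fl_scale a (\pi_free_lie t) = \pi_free_lie (LScale a t).
Proof. by apply/free_lieP/eqv_scale/free_lie_repr. Qed.

Lemma fl_lieE t u :
  fl_lie (\pi_free_lie t) (\pi_free_lie u) = \pi_free_lie (LBracket t u).
Proof. by apply/free_lieP/eqv_bracket; exact: free_lie_repr. Qed.

Lemma fl_addA : associative fl_add.
Proof.
elim/quotW=> t; elim/quotW=> u; elim/quotW=> v.
rewrite (fl_addE u v) (fl_addE t u) !fl_addE.
exact/free_lieP/eqv_addA.
Qed.

Lemma fl_addC : commutative fl_add.
Proof.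
by elim/quotW=> t; elim/quotW=> u; rewrite !fl_addE; exact/free_lieP/eqv_addC.
Qed.

Lemma fl_add0 : left_id fl_zero fl_add.
Proof. by elim/quotW=> t; rewrite fl_addE; exact/free_lieP/eqv_add0. Qed.

Lemma fl_addN : left_inverse fl_zero fl_opp fl_add.
Proof. by elim/quotW=> t; rewrite (fl_oppE t) fl_addE; exact/free_lieP/eqv_addN. Qed.

HB.instance Definition _ :=
  GRing.isZmodule.Build free_lie fl_addA fl_addC fl_add0 fl_addN.

Lemma fl_scaleA a b (x : free_lie) :
  fl_scale a (fl_scale b x) = fl_scale (a * b) x.
Proof.
elim/quotW: x => t; rewrite (fl_scaleE b t) !fl_scaleE.
exact/free_lieP/eqv_scaleA.
Qed.

Lemma fl_scale1 : left_id 1 fl_scale.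
Proof. by elim/quotW=> t; rewrite fl_scaleE; exact/free_lieP/eqv_scale1. Qed.

Lemma fl_scaleDr : right_distributive fl_scale +%R.
Proof.
move=> a; elim/quotW=> t; elim/quotW=> u; rewrite /GRing.add/=.
rewrite (fl_addE t u) (fl_scaleE a t) (fl_scaleE a u) fl_scaleE fl_addE.
exact/free_lieP/eqv_scaleDr.
Qed.

Lemma fl_scaleDl (x : free_lie) : {morph fl_scale^~ x : a b / a + b}.
Proof.
elim/quotW: x => t a b; rewrite [RHS]/GRing.add/=.
rewrite (fl_scaleE a t) (fl_scaleE b t) fl_addE fl_scaleE.
exact/free_lieP/eqv_scaleDl.
Qed.

HB.instance Definition _ := GRing.Zmodule_isLmodule.Build K free_lie
  fl_scaleA fl_scale1 fl_scaleDr fl_scaleDl.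

Lemma fl_lieDl (x y z : free_lie) : fl_lie (x + y) z = fl_lie x z + fl_lie y z.
Proof.
elim/quotW: x => t; elim/quotW: y => u; elim/quotW: z => v.
rewrite /GRing.add/= (fl_addE t u) (fl_lieE t v) (fl_lieE u v) fl_lieE fl_addE.
exact/free_lieP/eqv_bracketDl.
Qed.

Lemma fl_lieDr (x y z : free_lie) : fl_lie x (y + z) = fl_lie x y + fl_lie x z.
Proof.
elim/quotW: x => t; elim/quotW: y => u; elim/quotW: z => v.
rewrite /GRing.add/= (fl_addE u v) (fl_lieE t u) (fl_lieE t v) fl_lieE fl_addE.
exact/free_lieP/eqv_bracketDr.
Qed.

Lemma fl_lieZl a (x y : free_lie) : fl_lie (a *: x) y = a *: fl_lie x y.
Proof.
elim/quotW: x => t; elim/quotW: y => u.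
rewrite /GRing.scale/= (fl_scaleE a t) (fl_lieE t u) fl_lieE fl_scaleE.
exact/free_lieP/eqv_bracketZl.
Qed.

Lemma fl_lieZr a (x y : free_lie) : fl_lie x (a *: y) = a *: fl_lie x y.
Proof.
elim/quotW: x => t; elim/quotW: y => u.
rewrite /GRing.scale/= (fl_scaleE a u) (fl_lieE t u) fl_lieE fl_scaleE.
exact/free_lieP/eqv_bracketZr.
Qed.

Lemma fl_liexx (x : free_lie) : fl_lie x x = 0.
Proof. by elim/quotW: x => t; rewrite fl_lieE; exact/free_lieP/eqv_bracketxx. Qed.

Lemma fl_lie_jacobi (x y z : free_lie) :
  fl_lie x (fl_lie y z) + fl_lie y (fl_lie z x) + fl_lie z (fl_lie x y) = 0.
Proof.
elim/quotW: x => t; elim/quotW: y => u; elim/quotW: z => v.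
rewrite /GRing.add/= (fl_lieE u v) (fl_lieE v t) (fl_lieE t u).
rewrite (fl_lieE t (LBracket _ _)) (fl_lieE u (LBracket _ _)).
rewrite (fl_lieE v (LBracket _ _)) (fl_addE (LBracket t _)) fl_addE.
exact/free_lieP/eqv_jacobi.
Qed.

HB.instance Definition _ := Lmodule_isLieAlgebra.Build K free_lie
  fl_lieDl fl_lieDr fl_lieZl fl_lieZr fl_liexx fl_lie_jacobi.

End FreeLie.

Arguments lie_gen K {X}.

Section Universal.
Variables (K : fieldType) (X : Type) (L : lieAlgType K) (f : X -> L).

Fixpoint lie_term_eval (t : lie_term K X) : L :=
  match t with
  | LGen x => f x
  | LZero => 0
  | LOpp t => - lie_term_eval t
  | LAdd t u => lie_term_eval t + lie_term_eval u
  | LScale a t => a *: lie_term_eval t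
  | LBracket t u => lie (lie_term_eval t) (lie_term_eval u)
  end.

Lemma lie_term_eval_eqv t u :
  lie_eqv t u -> lie_term_eval t = lie_term_eval u.
Proof.
elim=> //=.
- by move=> ? ? ? _ -> _ ->.
- by move=> ? ? _ ->.
- by move=> ? ? ? ? _ -> _ ->.
- by move=> ? ? ? _ ->.
- by move=> ? ? ? ? _ -> _ ->.
- by move=> *; rewrite addrA.
- by move=> *; rewrite addrC.
- by move=> *; rewrite add0r.
- by move=> *; rewrite addNr.
- by move=> *; rewrite scalerA.
- by move=> *; rewrite scale1r.
- by move=> *; rewrite scalerDr.
- by move=> *; rewrite scalerDl.
- by move=> *; rewrite lieDl.
- by move=> *; rewrite lieDr.
- by move=> *; rewrite lieZl.
- by move=> *; rewrite lieZr.
- by move=> *; rewrite liexx.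
- by move=> *; rewrite lie_jacobi.
Qed.

Definition free_lie_lift (x : free_lie K X) : L := lie_term_eval (repr x).

Lemma free_lie_liftE t : free_lie_lift (\pi t) = lie_term_eval t.
Proof. exact/lie_term_eval_eqv/free_lie_repr. Qed.

Theorem free_lie_universal :
  exists! g : free_lie K X -> L,
    [/\ forall a x y, g (a *: x + y) = a *: g x + g y,
        forall x y, g (lie x y) = lie (g x) (g y) &
        forall x, g (lie_gen K x) = f x].
Proof.
exists free_lie_lift; split.
  split=> [a|x y|x].
  - elim/quotW=> t; elim/quotW=> u.
    by rewrite /GRing.add /GRing.scale/= fl_scaleE fl_addE !free_lie_liftE.
  - elim/quotW: x => t; elim/quotW: y => u.
    by rewrite /lie/= fl_lieE !free_lie_liftE.
  - exact: free_lie_liftE.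
move=> g [glin glie ggen]; apply/funext; elim/quotW=> t.
rewrite free_lie_liftE.
have g0 : g 0 = 0.
  by have := glin (-1) 0 0; rewrite scaler0 addr0 scaleN1r addNr.
have gZ a x : g (a *: x) = a *: g x by have := glin a x 0; rewrite g0 !addr0.
have gD x y : g (x + y) = g x + g y by have := glin 1 x y; rewrite !scale1r.
elim: t => [x||t IH|t IHt u IHu|a t IH|t IHt u IHu] /=.
- by rewrite -ggen.
- by rewrite -g0.
- by rewrite IH -scaleN1r -gZ scaleN1r -fl_oppE.
- by rewrite IHt IHu -gD -fl_addE.
- by rewrite IH -gZ -fl_scaleE.
- by rewrite IHt IHu -glie -fl_lieE.
Qed.

End Universal.

Inductive br (X : Type) := Leaf of X | Node of br X & br X.

HB.instance Definition _ X := gen_eqMixin (br X).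
HB.instance Definition _ X := gen_choiceMixin (br X).

Fixpoint ev (K : fieldType) (X : Type) (t : br X) : free_lie K X :=
  match t with
  | Leaf x => lie_gen K x
  | Node t1 t2 => lie (ev K t1) (ev K t2)
  end.

Section Hall.
Variable X : Type.
Implicit Types (B : set (br X)) (lt : br X -> br X -> Prop).

(* The order is only constrained on B: values of lt outside B are junk. *)
Definition strict_total_order_on B lt : Prop :=
  [/\ forall a, B a -> ~ lt a a,
      forall a b c, B a -> B b -> B c -> lt a b -> lt b c -> lt a c &
      forall a b, B a -> B b -> [\/ lt a b, a = b | lt b a]].

(* "t is a letter, or its left factor is at most b". *)
Definition letter_or_left_le lt (t b : br X) : Prop :=
  match t with
  | Leaf _ => True
  | Node l _ => lt l b \/ l = b
  end.

Record hall_set B lt : Prop := {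
  hall_order : strict_total_order_on B lt;
  hall_letter : forall x, B (Leaf x);
  hall_node : forall b1 b2, B (Node b1 b2) <->
    [/\ B b1, B b2, lt b1 b2 & letter_or_left_le lt b2 b1];
  hall_lt_node : forall b1 b2,
    B b1 -> B b2 -> B (Node b1 b2) -> lt b1 (Node b1 b2)
}.

End Hall.

Section HallNorm.
Variables (K : numFieldType) (X : Type) (B : set (br X)).
Local Open Scope classical_set_scope.

Definition expansion (u : free_lie K X) (alpha : br X -> K) : Prop :=
  [/\ finite_set [set c | alpha c != 0],
      [set c | alpha c != 0] `<=` B &
      u = \sum_(c \in B) alpha c *: ev K c].

(* When B is a Hall set, [expansion u] has exactly one element, since ev is
   injective on B and ev(B) is a basis (Viennot); for other B the chosen
   coordinates are junk. *)
Definition hall_coord (u : free_lie K X) : br X -> K :=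
  xget (fun=> 0) (expansion u).

Definition hall_norm (u : free_lie K X) : K :=
  \sum_(c \in B) `|hall_coord u c|.

End HallNorm.

(* [left_nested [:: y1; y2; ...; ym]] is [...[[y1, y2], y3], ..., ym] (junk
   value 0 for the empty list). *)
Definition left_nested (K : fieldType) (X : Type) (s : seq X) : free_lie K X :=
  match s with
  | [::] => 0
  | x :: s' => foldl (fun u y => lie u (lie_gen K y)) (lie_gen K x) s'
  end.

(* Main.v *)
Require Import Defs.
From HB Require Import structures.
From mathcomp Require Import all_boot all_order all_algebra.
From mathcomp Require Import boolp classical_sets cardinality fsbigop reals.

(* Order trees by rightmost leaf, then by size, and take the Hall set of this
   order.  Up to sign, the left-nested bracket is obtained from X_n by applying
   ad X_{n-1}, ..., ad X_1 successively.  As ad x is a derivation, it maps a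
   tree to the sum over its leaves y of the trees with y replaced by (x, y).
   When x is smaller than all the letters in use, this leaves the rightmost
   leaf of every existing subtree unchanged, so the new trees are still Hall
   trees.  No coefficient changes sign, hence the norm is multiplied by the
   number of leaves at each step: 1 * 2 * ... * (n-1).

   The linear independence of a Hall set comes from Lazard elimination: in a
   finite subtree-closed part of it, the least element x is a letter, and the
   morphism L(Z) -> K x + L(Z) (semidirect product by the derivation
   z |-> (x, z)) which sends x to x and fixes the other letters maps every other
   Hall tree to its evaluation in the alphabet where x has been replaced by the
   letters (x, (x, ... (x, z))).  To keep one alphabet throughout, Z is
   the type of all trees. *)

Set Implicit Arguments.
Unset Strict Implicit.
Unset Printing Implicit Defensive.

Import Order.TTheory GRing.Theory Num.Theory.

Local Open Scope ring_scope.
Local Open Scope quotient_scope.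

(** * Linear maps and identities in Lie algebras *)

Section LinearMaps.
Variables (K : pzRingType) (U V : lmodType K) (g : U -> V).
Hypothesis glin : forall a x y, g (a *: x + y) = a *: g x + g y.

Lemma lin_map0 : g 0 = 0.
Proof. by have := glin (-1) 0 0; rewrite scaler0 addr0 scaleN1r addNr. Qed.

Lemma lin_map_comb I (r : seq I) (a : I -> K) (F : I -> U) :
  g (\sum_(i <- r) a i *: F i) = \sum_(i <- r) a i *: g (F i).
Proof.
by elim: r => [|i r IHr]; rewrite ?big_nil ?lin_map0// !big_cons glin IHr.
Qed.

End LinearMaps.

Section LieAlgebraTheory.
Variables (K : pzRingType) (L : lieAlgType K).
Implicit Types x y z : L.

Lemma lieC x y : lie x y = - lie y x.
Proof.
apply/eqP; rewrite -addr_eq0.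
by have := liexx (x + y); rewrite lieDl !lieDr !liexx add0r addr0 => ->.
Qed.

Lemma lie0r x : lie x 0 = 0.
Proof. by rewrite -[X in lie x X](scale0r x) lieZr scale0r. Qed.

Lemma lieNr x y : lie x (- y) = - lie x y.
Proof. by rewrite -scaleN1r lieZr scaleN1r. Qed.

Lemma lie_sumr I (r : seq I) x (F : I -> L) :
  lie x (\sum_(i <- r) F i) = \sum_(i <- r) lie x (F i).
Proof. exact: (big_morph _ (lieDr x) (lie0r x)). Qed.

Lemma lie_suml I (r : seq I) (F : I -> L) x :
  lie (\sum_(i <- r) F i) x = \sum_(i <- r) lie (F i) x.
Proof.
by rewrite lieC lie_sumr -sumrN; apply: eq_bigr => i _; rewrite -lieC.
Qed.

Lemma lie_derivation x y z :
  lie x (lie y z) = lie (lie x y) z + lie y (lie x z).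
Proof.
rewrite (lieC (lie x y)) (lieC x z) lieNr -opprD.
by apply/eqP; rewrite -addr_eq0 (addrC (lie z _)) addrA lie_jacobi.
Qed.

End LieAlgebraTheory.

(** * Derivations and semidirect products *)

Record derivation (K : comPzRingType) (L : lieAlgType K) := Derivation {
  derivation_fun :> L -> L;
  derivationP : forall a u v,
    derivation_fun (a *: u + v) = a *: derivation_fun u + derivation_fun v;
  derivation_lie : forall u v, derivation_fun (lie u v) =
    lie (derivation_fun u) v + lie u (derivation_fun v)
}.

(** The pair [(a, u)] stands for a x + u, where x is an added element whose bracket acts on [L] as
    [D]. The type mentions [D] because the bracket depends on it. *)
Definition semidirect (K : comPzRingType) (L : lieAlgType K)
  (D : derivation L) : Type := (K^o * L)%type.

Section Semidirect.
Variables (K : comPzRingType) (L : lieAlgType K) (D : derivation L).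

Lemma derivation0 : D 0 = 0.
Proof. exact: lin_map0 (derivationP D). Qed.

Lemma derivationD u v : D (u + v) = D u + D v.
Proof. by have := derivationP D 1 u v; rewrite !scale1r. Qed.

Lemma derivationZ a u : D (a *: u) = a *: D u.
Proof. by have := derivationP D a u 0; rewrite derivation0 !addr0. Qed.

Lemma derivationN u : D (- u) = - D u.
Proof. by rewrite -scaleN1r derivationZ scaleN1r. Qed.

HB.instance Definition _ :=
  GRing.Lmodule.copy (semidirect D) (K^o * L)%type.

Definition sd_lie (p q : semidirect D) : semidirect D :=
  (0, p.1 *: D q.2 - q.1 *: D p.2 + lie p.2 q.2).

Lemma sd_lieC p q : sd_lie p q = - sd_lie q p.
Proof.
by rewrite /sd_lie/= {1}lieC; congr pair; rewrite /= ?oppr0// opprD opprB.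
Qed.

Lemma sd_lieDr p q r : sd_lie p (q + r) = sd_lie p q + sd_lie p r.
Proof.
congr pair; rewrite /= ?addr0// derivationD lieDr scalerDl scalerDr opprD.
by rewrite [RHS]addrACA; congr (_ + _); exact: addrACA.
Qed.

Lemma sd_lieZr a p q : sd_lie p (a *: q) = a *: sd_lie p q.
Proof.
congr pair; rewrite /= ?scaler0// derivationZ lieZr !scalerDr scalerN !scalerA.
by rewrite mulrC.
Qed.

Lemma sd_lieDl p q r : sd_lie (p + q) r = sd_lie p r + sd_lie q r.
Proof. by rewrite sd_lieC sd_lieDr opprD -!sd_lieC. Qed.

Lemma sd_lieZl a p q : sd_lie (a *: p) q = a *: sd_lie p q.
Proof. by rewrite sd_lieC sd_lieZr -scalerN -sd_lieC. Qed.

Lemma sd_liexx p : sd_lie p p = 0.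
Proof. by rewrite /sd_lie subrr liexx addr0. Qed.

Lemma sd_lie_jacobi p q r :
  sd_lie p (sd_lie q r) + sd_lie q (sd_lie r p) + sd_lie r (sd_lie p q) = 0.
Proof.
case: p q r => [a u] [b v] [c w]; congr pair; rewrite /= ?addr0//.
rewrite !scale0r !subr0 !derivationD !derivationN !derivationZ !derivation_lie.
rewrite !lieDr !lieNr !lieZr !scalerDr !scalerN !scalerA.
rewrite (mulrC b a) (mulrC c a) (mulrC c b).
rewrite (lieC (D v) w) (lieC (D w) u) (lieC (D u) v) !scalerN.
rewrite -[RHS](lie_jacobi u v w).
(* The three iterated brackets come first; the other eighteen terms cancel in pairs. *)
rewrite (AC (2*2*3*(2*2*3)*(2*2*3))%AC
  (7*14*21*(1*9)*(2*15)*(8*16)*(3*19)*(4*13)*(5*10)*(6*18)*(11*20)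
   *(12*17))%AC)/=.
by rewrite !(subrr, addNr, addr0).
Qed.

HB.instance Definition _ := Lmodule_isLieAlgebra.Build K (semidirect D)
  sd_lieDl sd_lieDr sd_lieZl sd_lieZr sd_liexx sd_lie_jacobi.

End Semidirect.

(** * Derivations of the free Lie algebra with prescribed values on letters *)

Section FreeLieDerivation.
Variables (K : fieldType) (X : Type) (d : X -> free_lie K X).

Notation cls := (\pi_(free_lie K X)).

Lemma pi_add t u : cls (LAdd t u) = cls t + cls u.
Proof. by rewrite -fl_addE. Qed.

Lemma pi_scale a t : cls (LScale a t) = a *: cls t.
Proof. by rewrite -fl_scaleE. Qed.

Lemma pi_bracket t u : cls (LBracket t u) = lie (cls t) (cls u).
Proof. by rewrite /lie/= fl_lieE. Qed.

Fixpoint der_term (t : lie_term K X) : free_lie K X :=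
  match t with
  | LGen x => d x
  | LZero => 0
  | LOpp t => - der_term t
  | LAdd t u => der_term t + der_term u
  | LScale a t => a *: der_term t
  | LBracket t u => lie (der_term t) (cls u) + lie (cls t) (der_term u)
  end.

Lemma der_term_eqv t u : lie_eqv t u -> der_term t = der_term u.
Proof.
elim=> {t u} /=.
- by [].
- by move=> t u _ ->.
- by move=> u t v _ -> _ ->.
- by move=> t t' _ ->.
- by move=> t t' u u' _ -> _ ->.
- by move=> a t t' _ ->.
- by move=> t t' u u' /free_lieP-> -> /free_lieP-> ->.
- by move=> t u v; rewrite addrA.
- by move=> t u; rewrite addrC.
- by move=> t; rewrite add0r.
- by move=> t; rewrite addNr.
- by move=> a b t; rewrite scalerA.
- by move=> t; rewrite scale1r.
- by move=> a t u; rewrite scalerDr.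
- by move=> a b t; rewrite scalerDl.
- by move=> t u v; rewrite pi_add !lieDl addrACA.
- by move=> t u v; rewrite pi_add !lieDr addrACA.
- by move=> a t u; rewrite pi_scale !lieZl scalerDr.
- by move=> a t u; rewrite pi_scale !lieZr scalerDr.
- by move=> t; rewrite lieC addNr.
move=> t u v; rewrite !pi_bracket !lieDr.
move: (cls t) (cls u) (cls v) (der_term t) (der_term u) (der_term v).
move=> x y z x' y' z'.
(* The nine terms form three Jacobi identities, each with one of x, y, z replaced by its
   derivative. *)
rewrite (AC (1*2*(1*2)*(1*2))%AC (1*6*8*(2*4*9)*(3*5*7))%AC)/=.
by rewrite !lie_jacobi !addr0.
Qed.

Definition free_lie_der (u : free_lie K X) : free_lie K X := der_term (repr u).

Lemma free_lie_derE t : free_lie_der (cls t) = der_term t.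
Proof. exact/der_term_eqv/free_lie_repr. Qed.

Lemma free_lie_der_gen x : free_lie_der (lie_gen K x) = d x.
Proof. exact: free_lie_derE. Qed.

Lemma free_lie_derP a u v :
  free_lie_der (a *: u + v) = a *: free_lie_der u + free_lie_der v.
Proof.
elim/quotW: u => t; elim/quotW: v => u.
by rewrite -pi_scale -pi_add !free_lie_derE.
Qed.

Lemma free_lie_der_lie u v : free_lie_der (lie u v) =
  lie (free_lie_der u) v + lie u (free_lie_der v).
Proof.
elim/quotW: u => t; elim/quotW: v => u.
by rewrite -pi_bracket !free_lie_derE.
Qed.

Definition free_lie_derivation := Derivation free_lie_derP free_lie_der_lie.

End FreeLieDerivation.

(** * Linear independence of Hall trees by elimination *)

Section HallIndependence.
Variables (K : fieldType) (X : Type).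
Notation tree := (br X).

Definition subtree_closed (F : seq tree) : Prop :=
  forall a b, Node a b \in F -> a \in F /\ b \in F.

Fixpoint subtrees (t : tree) : seq tree :=
  t :: match t with Leaf _ => [::] | Node a b => subtrees a ++ subtrees b end.

Lemma subtrees_refl t : t \in subtrees t.
Proof. by case: t => *; rewrite mem_head. Qed.

Lemma subtrees_closed t : subtree_closed (subtrees t).
Proof.
elim: t => [x|t IHt u IHu] a b; first by rewrite inE => /eqP.
rewrite /= !inE mem_cat => /or3P[/eqP[-> ->]|/IHt[at_ bt]|/IHu[au bu]].
- by rewrite !mem_cat !subtrees_refl !orbT.
- by rewrite !mem_cat at_ bt !orbT.
- by rewrite !mem_cat au bu !orbT.
Qed.

(* The evaluation of t once the letters in E have been eliminated: the new
   letters are the trees which are leaves or have their left factor in E. *)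
Fixpoint stage_ev (E : seq tree) (t : tree) : free_lie K tree :=
  match t with
  | Leaf _ => lie_gen K t
  | Node a b =>
    if a \in E then lie_gen K t else lie (stage_ev E a) (stage_ev E b)
  end.

Definition graft_left (x : tree) : derivation (free_lie K tree) :=
  free_lie_derivation (fun z => lie_gen K (Node x z)).

Definition elim_letter (x z : tree) : semidirect (graft_left x) :=
  if z == x then (1, 0) else (0, lie_gen K z).

Variables (B : set tree) (lt : tree -> tree -> Prop).
Hypothesis hallB : hall_set B lt.

Let ltb (a b : tree) : bool := `[< lt a b >].

Lemma hall_ltxx a : B a -> ~ lt a a.
Proof. by case: hallB => -[ltxx _ _] _ _ _; exact: ltxx. Qed.

Lemma hall_lt_trans a b c : B a -> B b -> B c -> lt a b -> lt b c -> lt a c.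
Proof. by case: hallB => -[_ lttr _] _ _ _; exact: lttr. Qed.

Lemma hall_lt_total a b : B a -> B b -> [\/ lt a b, a = b | lt b a].
Proof. by case: hallB => -[_ _ lttot] _ _ _; exact: lttot. Qed.

Lemma hall_nodeP a b : B (Node a b) ->
  [/\ B a, B b, lt a b & letter_or_left_le lt b a].
Proof. by move/(hall_node hallB). Qed.

Lemma hall_left_lt a b : B (Node a b) -> lt a (Node a b).
Proof.
by move=> Bab; have [Ba Bb _ _] := hall_nodeP Bab; apply: (hall_lt_node hallB).
Qed.

Section Cut.
Variables (E s : seq tree) (x : tree).
Hypothesis FB : forall t, t \in E ++ x :: s -> B t.
Hypothesis Flt : pairwise ltb (E ++ x :: s).
Hypothesis Fclosed : subtree_closed (E ++ x :: s).

(** In this increasing list, [E] is already eliminated, [x] comes next and [s] remains. If [b] is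
    not in [s], it is at most [x], so anything below it lies in [E]. *)
Lemma lt_cut a b : a \in E ++ x :: s -> b \in E ++ x :: s -> lt a b ->
  a \in E \/ b \in s.
Proof.
move=> aF bF ltab; have [Ba Bb] := (FB aF, FB bF).
have nltba : ~ lt b a.
  by move=> ltba; apply: (hall_ltxx Ba); exact: hall_lt_trans ltab ltba.
have neqab : a <> b by move=> eab; rewrite eab in ltab; exact: hall_ltxx ltab.
move: Flt; rewrite pairwise_cat /= => /and3P[/allrelP ltE _ /andP[/allP ltx _]].
move: aF; rewrite mem_cat => /orP[->|axs]; first by left.
move: bF; rewrite mem_cat => /orP[bE|].
  by have /asboolP := ltE _ _ bE axs.
rewrite inE => /orP[/eqP bx|->]; last by right.
move: axs; rewrite inE => /orP[/eqP ax|/ltx/asboolP]; last by rewrite -bx.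
by case: neqab; rewrite ax bx.
Qed.

Lemma cut_notin : x \notin s.
Proof.
apply/negP => xs; have xF : x \in E ++ x :: s by rewrite mem_cat mem_head orbT.
move: Flt; rewrite pairwise_cat /= => /and3P[_ _ /andP[/allP/(_ _ xs)/asboolP]].
by move/(hall_ltxx (FB xF)).
Qed.

Lemma lt_cut_left a : a \in E ++ x :: s -> lt a x -> a \in E.
Proof.
move=> aF /(lt_cut aF)[||xs]//; first by rewrite mem_cat mem_head orbT.
by have := cut_notin; rewrite xs.
Qed.

(** The left factor of a Hall node is smaller than the node, so that of [x], if any, has been
    eliminated before. *)
Lemma stage_ev_cut : stage_ev E x = lie_gen K x.
Proof.
have xF : x \in E ++ x :: s by rewrite mem_cat mem_head orbT.
case def_x: {1 2}x => [//|a b] /=; rewrite ifT// -?def_x//.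
have abF : Node a b \in E ++ x :: s by rewrite -def_x.
have [aF _] := Fclosed abF.
by apply: lt_cut_left => //; rewrite def_x; apply: hall_left_lt; exact: FB.
Qed.

Lemma elim_stage_ev (g : free_lie K tree -> semidirect (graft_left x)) :
    (forall u v, g (lie u v) = lie (g u) (g v)) ->
    (forall z, g (lie_gen K z) = elim_letter x z) ->
  forall t, t \in s -> g (stage_ev E t) = (0, stage_ev (rcons E x) t).
Proof.
move=> glie ggen; have sF t : t \in s -> t \in E ++ x :: s.
  by move=> ts; rewrite mem_cat inE ts !orbT.
have ggen' t : t \in s -> g (lie_gen K t) = (0, lie_gen K t).
  move=> ts; rewrite ggen /elim_letter; case: eqP => // tx.
  by have := cut_notin; rewrite -tx ts.
elim=> [y|a IHa b IHb] ts; first by rewrite /= ggen'.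
have [aF bF] := Fclosed (sF _ ts).
have [Ba Bb ltab leab] := hall_nodeP (FB (sF _ ts)).
rewrite /= mem_rcons inE; case: ifPn => [aE|aE].
  by rewrite orbT ggen'.
(* Now [a] is [x] or in [s]. In the second case both factors have zero scalar part and the brackets
   agree. *)
have bs : b \in s by case: (lt_cut aF bF ltab) => //; rewrite (negbTE aE).
rewrite glie (IHb bs) orbF; case: eqP => [ax|ax]; last first.
  have as_ : a \in s.
    by move: aF; rewrite mem_cat inE (negbTE aE); case: eqP.
  by rewrite (IHa as_) /lie/= /sd_lie/= !scale0r subr0 add0r.
(* As [a] is [x], the Hall condition bounds the left factor of [b] by [x]: hence [b] is a letter
   after this elimination, and the derivation sends it to the letter [Node x b]. *)
have -> : stage_ev (rcons E x) b = lie_gen K b.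
  case def_b: {1 2}b => [//|c d] /=; rewrite ifT// -?def_b//.
  rewrite mem_rcons inE; move: leab; rewrite def_b ax => -[ltcx|->]; last first.
    by rewrite eqxx.
  rewrite lt_cut_left ?orbT//.
  by move: bF; rewrite def_b => /Fclosed[].
rewrite ax stage_ev_cut ggen /elim_letter eqxx /lie/= /sd_lie/=.
by rewrite scale1r scale0r subr0 lieC lie0r oppr0 addr0 free_lie_der_gen.
Qed.

End Cut.

Lemma stage_ev_independent (s E : seq tree) (al : tree -> K) :
    (forall t, t \in E ++ s -> B t) -> pairwise ltb (E ++ s) ->
    subtree_closed (E ++ s) ->
    \sum_(t <- s) al t *: stage_ev E t = 0 ->
  forall t, t \in s -> al t = 0.
Proof.
elim: s E => [//|x s IHs] E FB Flt Fclosed.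
have [g [[glin glie ggen] _]] := free_lie_universal (elim_letter x).
move/(congr1 g); rewrite lin_map_comb// big_cons (stage_ev_cut FB Flt Fclosed).
rewrite (lin_map0 glin) ggen /elim_letter eqxx.
rewrite (eq_big_seq (fun t => (0, al t *: stage_ev (rcons E x) t))); last first.
  move=> t ts; rewrite (elim_stage_ev FB Flt Fclosed)//.
  by congr pair; rewrite scaler0.
rewrite (_ : \sum_(t <- s) _ =
    (0, \sum_(t <- s) al t *: stage_ev (rcons E x) t)).
  move=> sum0 t.
  (* The scalar part isolates the coefficient of [x]; the other part is the same relation at the
     next stage. *)
  have /= := congr1 fst sum0; rewrite addr0 /GRing.scale/= mulr1 => alx0.
  have /= := congr1 snd sum0; rewrite scaler0 add0r => sum0'.
  by rewrite inE => /orP[/eqP->//|]; apply: IHs sum0' t; rewrite cat_rcons.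
elim: s {IHs FB Flt Fclosed} => [|t s IHs]; first by rewrite !big_nil.
by rewrite !big_cons IHs; congr pair; rewrite /= addr0.
Qed.

Lemma hall_independent (s : seq tree) (al : tree -> K) :
    uniq s -> (forall t, t \in s -> B t) ->
    \sum_(t <- s) al t *: ev K t = 0 ->
  forall t, t \in s -> al t = 0.
Proof.
move=> us sB sum0.
have subB t u : B t -> u \in subtrees t -> B u.
  elim: t => [y|a IHa b IHb] Bt /=; first by rewrite inE => /eqP->.
  have [Ba Bb _ _] := hall_nodeP Bt.
  by rewrite inE mem_cat => /or3P[/eqP->//|/(IHa Ba)|/(IHb Bb)].
pose leb a b := `[< lt a b \/ a = b >].
pose F := sort leb (undup (flatten [seq subtrees t | t <- s])).
have memF t : t \in F <-> exists2 u, u \in s & t \in subtrees u.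
  by rewrite mem_sort mem_undup; split=> [/flatten_mapP|/flatten_mapP].
have FB t : t \in F -> B t by move=> /memF[u /sB]; exact: subB.
have Fclosed : subtree_closed F.
  move=> a b /memF[u us' /subtrees_closed[au bu]].
  by split; apply/memF; exists u.
have Flt : pairwise ltb F.
  have uF : uniq F by rewrite sort_uniq undup_uniq.
  have BF : all (fun t => `[< B t >]) F by apply/allP => t /FB/asboolP.
  have leF : pairwise leb F.
    (* [leb] is total and transitive only on [B], hence the relativized sorting lemmas; strictness
       then follows from uniqueness. *)
    rewrite -(sorted_pairwise_in _ BF).
      apply: (@sort_sorted_in _ (fun t => `[< B t >])).
        move=> a b /asboolP Ba /asboolP Bb.
        by apply/orP; case: (hall_lt_total Ba Bb) => ab; [left|left|right];
          apply/asboolP; [left|right|left].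
      by apply/allP => t tF; apply: (allP BF); rewrite mem_sort.
    move=> b a c /asboolP Bb /asboolP Ba /asboolP Bc /asboolP[ab|->//].
    move=> /asboolP[bc|<-]; apply/asboolP; left => //.
    exact: hall_lt_trans ab bc.
  elim: F uF leF {memF FB Fclosed BF} => //= x F IHF /andP[xF uF] /andP[leF lF].
  rewrite IHF// andbT; apply/allP => t tF; apply/asboolP.
  have /asboolP[//|xt] := allP leF _ tF.
  by rewrite xt tF in xF.
have sF t : t \in s -> t \in F.
  by move=> ts; apply/memF; exists t => //; exact: subtrees_refl.
(* Passing to the alphabet of trees turns [ev] into the stage where nothing is eliminated. *)
have [g [[glin glie ggen] _]] :=
  free_lie_universal (fun x : X => lie_gen K (Leaf x)).
have gev t : g (ev K t) = stage_ev [::] t.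
  by elim: t => [x|a IHa b IHb] /=; rewrite ?glie ?IHa ?IHb.
have /(_ FB Flt Fclosed) :=
  @stage_ev_independent F [::] (fun t => if t \in s then al t else 0).
move=> indF t ts; have := indF _ t (sF t ts); rewrite ts; apply.
under eq_bigr do rewrite (fun_if (fun a => a *: _)) scale0r.
rewrite -big_mkcond -big_filter.
rewrite (perm_big s) /=; last first.
  apply: uniq_perm => //; first by rewrite filter_uniq ?sort_uniq ?undup_uniq.
  by move=> u; rewrite mem_filter; case: (boolP (u \in s)) => //= /sF.
rewrite -[RHS](lin_map0 glin) -sum0 lin_map_comb//.
by apply: eq_bigr => u _; rewrite gev.
Qed.

End HallIndependence.

(** * Uniqueness of coordinates and computation of the norm *)

Section Coordinates.
Variables (X : Type) (B : set (br X)) (lt : br X -> br X -> Prop).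
Hypothesis hallB : hall_set B lt.
Local Open Scope classical_set_scope.

Lemma fsbig_sum_seq (V : nmodType) (r : seq (br X)) (F : br X -> V) :
    uniq r -> (forall c, c \in r -> B c) -> (forall c, F c != 0 -> c \in r) ->
  \sum_(c \in B) F c = \sum_(c <- r) F c.
Proof.
move=> ur rB Fr; rewrite (fsbigE r)//; last first.
  by move=> c _; apply: contraNeq; exact: Fr.
by rewrite big_seq_cond [RHS]big_seq; apply: eq_bigl => c;
  case: (boolP (c \in r)) => //= /rB Bc; rewrite mem_set.
Qed.

(** This identifies the chosen [hall_coord] with any explicit expansion. *)
Lemma expansion_unique (K : numFieldType) (u : free_lie K X)
    (al be : br X -> K) :
  expansion B u al -> expansion B u be -> al = be.
Proof.
move=> [/finite_seqP[ra era] alB ual] [/finite_seqP[rb erb] beB ube].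
pose r := undup (ra ++ rb).
have alr c : al c != 0 -> c \in r.
  move=> alc; rewrite mem_undup mem_cat; apply/orP; left.
  by have : [set` ra] c by rewrite -era.
have ber c : be c != 0 -> c \in r.
  move=> bec; rewrite mem_undup mem_cat; apply/orP; right.
  by have : [set` rb] c by rewrite -erb.
have rB c : c \in r -> B c.
  rewrite mem_undup mem_cat => /orP[cr|cr].
    by apply: alB; rewrite era.
  by apply: beB; rewrite erb.
have sumr (ga : br X -> K) : (forall c, ga c != 0 -> c \in r) ->
    \sum_(c \in B) ga c *: ev K c = \sum_(c <- r) ga c *: ev K c.
  move=> gar; apply: fsbig_sum_seq => //; first exact: undup_uniq.
  by move=> c /eqP gac; apply: gar; apply/eqP => ga0; case: gac;
    rewrite ga0 scale0r.
have sum0 : \sum_(c <- r) (al c - be c) *: ev K c = 0.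
  under eq_bigr do rewrite scalerBl.
  by rewrite big_split/= sumrN -!sumr// -ual -ube subrr.
apply/funext => c; apply/eqP; rewrite -subr_eq0.
have [cr|cr] := boolP (c \in r).
  by rewrite (hall_independent hallB _ rB sum0 cr) ?undup_uniq.
have -> : al c = 0 by apply: contraNeq cr; exact: alr.
have -> : be c = 0 by apply: contraNeq cr; exact: ber.
by rewrite subrr.
Qed.

(* All the coefficients have the same sign, so repetitions in s are harmless. *)
Lemma hall_norm_signed_sum (K : numFieldType) (n : nat) (s : seq (br X)) :
    (forall t, t \in s -> B t) ->
  hall_norm B ((-1) ^+ n *: \sum_(t <- s) ev K t) = (size s)%:R.
Proof.
move=> sB; pose al c : K := (-1) ^+ n * (count_mem c s)%:R.
have als c : al c != 0 -> c \in undup s.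
  rewrite mem_undup; apply: contraNT => /count_memPn cs.
  by rewrite /al cs mulr0.
have usB c : c \in undup s -> B c by rewrite mem_undup; exact: sB.
have count_sum (V : nmodType) (F : br X -> V) :
    \sum_(c <- undup s) F c *+ count_mem c s = \sum_(c <- s) F c.
  rewrite -[RHS]big_undup_iterop_count; apply: eq_bigr => c _.
  by case: (count_mem c s).
have exp_al : expansion B ((-1) ^+ n *: \sum_(t <- s) ev K t) al.
  split.
  - apply: (@sub_finite_set _ _ [set` undup s]) => [c /= /als//|].
    by apply/finite_seqP; exists (undup s).
  - by move=> c /= /als /usB.
  rewrite (@fsbig_sum_seq _ (undup s)) ?undup_uniq//; last first.
    by move=> c /eqP alc; apply: als; apply/eqP => al0; case: alc;
      rewrite al0 scale0r.
  rewrite -count_sum scaler_sumr; apply: eq_bigr => c _.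
  by rewrite /al -scalerA scaler_nat.
rewrite /hall_norm (_ : hall_coord B _ = al); last first.
  exact: expansion_unique (xgetPex _ (ex_intro _ al exp_al)) exp_al.
rewrite (@fsbig_sum_seq _ (undup s)) ?undup_uniq//; last first.
  by move=> c; rewrite normr_eq0; exact: als.
rewrite -sum1_size natr_sum -count_sum; apply: eq_bigr => c _.
by rewrite /al normrM normrX normrN1 expr1n mul1r normr_nat.
Qed.

End Coordinates.

(** * The Hall set ordered by rightmost leaf *)

Lemma gtn_ord_trans n : transitive (fun i j : 'I_n => j < i)%N.
Proof. by move=> i j k ij ki; exact: ltn_trans ki ij. Qed.

Section RightmostHallSet.
Variable n : nat.
Notation tree := (br 'I_n).
Implicit Types (t a b : tree) (x y : 'I_n).

Fixpoint rightmost t : 'I_n :=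
  match t with Leaf x => x | Node _ b => rightmost b end.

Fixpoint leaves t : seq 'I_n :=
  match t with Leaf x => [:: x] | Node a b => leaves a ++ leaves b end.

(** An embedding into a countable type, whose [pickle] numbers the trees injectively. *)
Fixpoint gen_tree t : GenTree.tree 'I_n :=
  match t with
  | Leaf x => GenTree.Leaf x
  | Node a b => GenTree.Node 0 [:: gen_tree a; gen_tree b]
  end.

Lemma gen_tree_inj : injective gen_tree.
Proof.
elim=> [x|a IHa b IHb] [y|c d] //= []; first by move->.
by move=> /IHa-> /IHb->.
Qed.

(* The last component only serves to make the order total. *)
Definition key t : nat *l (nat *l nat) :=
  (val (rightmost t), (size (leaves t), pickle (gen_tree t))).

Definition tree_lt a b : Prop := (key a < key b)%O.

Lemma key_inj : injective key.
Proof. by move=> a b [_ _ /(pcan_inj pickleK)/gen_tree_inj]. Qed.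

Lemma tree_lt_strict_total (A : set tree) : strict_total_order_on A tree_lt.
Proof.
split=> [a _|a b c _ _ _|a b _ _]; rewrite /tree_lt.
- by rewrite ltxx.
- exact: lt_trans.
- by case: (ltgtP (key a) (key b)) => [ab|ba|/key_inj ab];
    [constructor 1|constructor 3|constructor 2].
Qed.

Lemma rightmost_le a b : tree_lt a b -> (rightmost a <= rightmost b)%N.
Proof. by rewrite /tree_lt Order.ProdLexiOrder.ltxi_pair => /andP[]. Qed.

Lemma rightmost_lt a b : (rightmost a < rightmost b)%N -> tree_lt a b.
Proof.
move=> ab; rewrite /tree_lt Order.ProdLexiOrder.ltxi_pair !leEnat.
by rewrite ltnW//= leqNgt ab.
Qed.

Lemma leaves_gt0 t : (0 < size (leaves t))%N.
Proof. by elim: t => //= a IHa b IHb; rewrite size_cat addn_gt0 IHa. Qed.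

(** [Node a b] has the rightmost leaf of [b], which is at least that of [a]; in case of a tie, the
    size decides. *)
Lemma tree_lt_node a b : tree_lt a b -> tree_lt a (Node a b).
Proof.
move=> /rightmost_le ab; rewrite /tree_lt !Order.ProdLexiOrder.ltxi_pair.
rewrite !leEnat ltEnat/= ab/=; apply/implyP => _.
have la_lt : (size (leaves a) < size (leaves a ++ leaves b))%N.
  by rewrite size_cat -addn1 leq_add2l leaves_gt0.
by rewrite ltnW//= leqNgt la_lt.
Qed.

Fixpoint rightmost_hall t : Prop :=
  match t with
  | Leaf _ => True
  | Node a b => [/\ rightmost_hall a, rightmost_hall b, tree_lt a b &
                    letter_or_left_le tree_lt b a]
  end.

(** Membership is defined by recursion from the Hall conditions, so only the order and the last
    axiom require an argument. *)
Lemma rightmost_hall_set : hall_set rightmost_hall tree_lt.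
Proof.
split=> //; first exact: tree_lt_strict_total.
by move=> a b _ _ [_ _ /tree_lt_node].
Qed.

(** * Insertion of a letter at a leaf *)

Fixpoint insertions x t : seq tree :=
  match t with
  | Leaf _ => [:: Node (Leaf x) t]
  | Node a b => [seq Node a' b | a' <- insertions x a] ++
                [seq Node a b' | b' <- insertions x b]
  end.

Lemma lie_insertions (K : fieldType) x t :
  lie (lie_gen K x) (ev K t) = \sum_(t' <- insertions x t) ev K t'.
Proof.
elim: t => [y|a IHa b IHb] /=; first by rewrite big_seq1.
rewrite lie_derivation IHa IHb big_cat !big_map lie_suml lie_sumr.
by congr (_ + _).
Qed.

Lemma size_insertions x t : size (insertions x t) = size (leaves t).
Proof. by elim: t => //= a IHa b IHb; rewrite !size_cat !size_map IHa IHb. Qed.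

Lemma insertionsP x a b t : t \in insertions x (Node a b) ->
  (exists2 a', a' \in insertions x a & t = Node a' b) \/
  (exists2 b', b' \in insertions x b & t = Node a b').
Proof. by rewrite mem_cat => /orP[/mapP|/mapP]; [left|right]. Qed.

Lemma perm_leaves_insertions x t t' :
  t' \in insertions x t -> perm_eq (leaves t') (x :: leaves t).
Proof.
elim: t t' => [y|a IHa b IHb] t'; first by rewrite inE => /eqP->.
move=> /insertionsP[[a' /IHa pa ->]|[b' /IHb pb ->]] /=.
  by rewrite -cat_cons perm_cat2r.
apply: (@perm_trans _ (leaves a ++ [:: x] ++ leaves b)).
  by rewrite perm_cat2l.
by rewrite perm_catCA.
Qed.

Lemma rightmost_insertions x t t' :
  t' \in insertions x t -> rightmost t' = rightmost t.
Proof.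
elim: t t' => [y|a IHa b IHb] t'; first by rewrite inE => /eqP->.
by move=> /insertionsP[[a' _ ->]|[b' /IHb pb ->]].
Qed.

Lemma rightmost_leaf t : rightmost t \in leaves t.
Proof.
by elim: t => [x|a _ b IHb] /=; rewrite ?mem_head// mem_cat IHb orbT.
Qed.

(* A condition sufficient for membership in [rightmost_hall], and stable under
   insertion of a new smallest letter. *)
Fixpoint rightmost_increasing t : bool :=
  match t with
  | Leaf _ => true
  | Node a b =>
    [&& rightmost_increasing a, rightmost_increasing b,
        (rightmost a < rightmost b)%N &
        if b is Node c _ then (rightmost c < rightmost a)%N else true]
  end.

Lemma rightmost_increasing_hall t : rightmost_increasing t -> rightmost_hall t.
Proof.
elim: t => //= a IHa b IHb /and4P[/IHa ha /IHb hb /rightmost_lt ab].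
by case: b ab {IHb hb} (hb) => //= c d ab hb /rightmost_lt ca; split=> //; left.
Qed.

Lemma rightmost_increasing_insertions x t t' :
    {in leaves t, forall y, x < y}%N -> rightmost_increasing t ->
  t' \in insertions x t -> rightmost_increasing t'.
Proof.
elim: t t' => [y|a IHa b IHb] t' xt.
  by rewrite inE => _ /eqP-> /=; rewrite xt ?mem_head.
have xa : {in leaves a, forall y, x < y}%N.
  by move=> y ya; apply: xt; rewrite /= mem_cat ya.
have xb : {in leaves b, forall y, x < y}%N.
  by move=> y yb; apply: xt; rewrite /= mem_cat yb orbT.
move=> /= /and4P[ia ib ab cb].
move=> /insertionsP[[a' a'a ->]|[b' b'b ->]] /=.
  by rewrite (IHa _ xa ia a'a) ib (rightmost_insertions a'a) ab.
rewrite ia (IHb _ xb ib b'b) (rightmost_insertions b'b) ab /=.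
(* If [b] is a leaf, it becomes a node with left factor [x], which is below the rightmost leaf of
   [a]; if [b] is a node, its left factor keeps its rightmost leaf. *)
case: b {IHb xt xb ib ab} cb b'b => [y _|c d cb].
  by rewrite inE => /eqP->; rewrite xa ?rightmost_leaf.
move=> /insertionsP[[c' /rightmost_insertions c'c ->]|[d' _ ->]] //.
by rewrite c'c.
Qed.

(** * Iterated insertion: sign, number of trees, Hall property *)

Definition insert_all (T : seq tree) x := flatten [seq insertions x t | t <- T].

(** The letter is bracketed on the right but insertions describe its bracket on the left, so each
    letter costs one sign. *)
Lemma foldl_lie_insert_all (K : fieldType) (s : seq 'I_n) T m :
  foldl (fun u y => lie u (lie_gen K y)) ((-1) ^+ m *: \sum_(t <- T) ev K t) s =
  (-1) ^+ (m + size s) *: \sum_(t <- foldl insert_all T s) ev K t.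
Proof.
elim: s T m => [|x s IHs] T m /=; first by rewrite addn0.
rewrite addnS -addSn -IHs; congr foldl.
rewrite lieC lieZr exprS mulN1r scaleNr lie_sumr; congr (- (_ *: _)).
rewrite big_flatten big_map /=; apply: eq_bigr => t _.
exact: lie_insertions.
Qed.

Lemma size_foldl_insert_all (s : seq 'I_n) T m :
    {in T, forall t, size (leaves t) = m.+1} ->
  (size (foldl insert_all T s) * m`! = size T * (m + size s)`!)%N.
Proof.
elim: s T m => [|x s IHs] T m Tm /=; first by rewrite addn0.
have sizeT : size (insert_all T x) = (size T * m.+1)%N.
  rewrite size_flatten /shape -map_comp sumnE big_map.
  rewrite (eq_big_seq (fun=> m.+1)) => [|t tT /=]; last first.
    by rewrite size_insertions Tm.
  by rewrite big_const_seq count_predT iter_addn_0 mulnC.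
have := IHs (insert_all T x) m.+1; rewrite sizeT factS addSnnS => IH.
apply/eqP; rewrite -(eqn_pmul2r (ltn0Sn m)); apply/eqP.
rewrite -mulnA (mulnC m`!) IH; first by rewrite -!mulnA (mulnC m.+1).
move=> t /flatten_mapP[t0 /Tm t0m /perm_leaves_insertions/perm_size->] /=.
by rewrite t0m.
Qed.

Lemma foldl_insert_all_increasing (s : seq 'I_n) T :
    sorted (fun x y => y < x)%N s ->
    {in T, forall t, rightmost_increasing t /\
       {in s & leaves t, forall x y, x < y}%N} ->
  {in foldl insert_all T s, forall t, rightmost_increasing t}.
Proof.
elim: s T => [|x s IHs] T /= ss Tinc; first by move=> t /Tinc[].
apply: IHs => [|t]; first exact: path_sorted ss.
move=> /flatten_mapP[t0 /Tinc[inc0 lt0] t0t]; split.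
  apply: rightmost_increasing_insertions t0t => // y.
  exact: lt0 (mem_head _ _).
(* The only new leaf is [x], and the letters still to be inserted are below it because [s]
   decreases. *)
move=> z y zs; rewrite (perm_mem (perm_leaves_insertions t0t)) inE.
move=> /orP[/eqP->|yt0]; last by rewrite lt0// inE zs orbT.
by have /allP/(_ z zs) := order_path_min (@gtn_ord_trans n) ss.
Qed.

End RightmostHallSet.

(* The letter X_i is the ordinal i - 1 in 'I_n, so that rev (enum 'I_n) is the
   sequence X_n, X_{n-1}, ..., X_1. *)
Theorem corollary3p13 (R : realType) (k : scalars) (n : nat) (hn : (2 <= n)%N) :
  exists (B : set (br 'I_n)) (lt : br 'I_n -> br 'I_n -> Prop),
    hall_set B lt /\
    hall_norm B (left_nested (base_field R k) (rev (enum 'I_n)))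
      = ((n.-1)`!)%:R.
Proof.
exists (@rightmost_hall n), (@tree_lt n).
split; first exact: rightmost_hall_set.
have sorted_rev : sorted (fun x y : 'I_n => y < x)%N (rev (enum 'I_n)).
  rewrite rev_sorted -(@sorted_map _ _ val ltn) val_enum_ord.
  exact: iota_ltn_sorted.
have : size (rev (enum 'I_n)) = n by rewrite size_rev size_enum_ord.
case: (rev _) sorted_rev => [|x s]; first by move=> _ n0; rewrite -n0 in hn.
move=> sorted_xs /(congr1 predn)/= size_s.
(* The head [x] is X_n, taken as a single one-leaf tree with sign exponent 0; the n - 1 letters of
   [s] are then inserted. *)
have := foldl_lie_insert_all (base_field R k) s [:: Leaf x] 0.
rewrite big_seq1 scale1r /= => ->.
rewrite (hall_norm_signed_sum (@rightmost_hall_set n)).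
  have := @size_foldl_insert_all _ s [:: Leaf x] 0.
  rewrite /= muln1 mul1n add0n size_s => -> // t.
  by rewrite inE => /eqP->.
move=> t /foldl_insert_all_increasing inc; apply: rightmost_increasing_hall.
apply: inc => [|t0]; first exact: path_sorted sorted_xs.
rewrite inE => /eqP->; split=> // z y zs /=; rewrite inE => /eqP->.
by have /allP/(_ z zs) := order_path_min (@gtn_ord_trans n) sorted_xs.
Qed.
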